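(* Let $\mathcal{F}$ be a reproducing kernel Hilbert space of real-valued functions on a set $\mathcal{X}$ with norm $\|\cdot\|$ and orthogonal decomposition $\mathcal{F}=\{1\}\oplus\bigoplus_{\alpha=1}^p\mathcal{F}^\alpha$, where $\{1\}$ is the space of constants, and let $P^\alpha$ be the orthogonal projection onto $\mathcal{F}^\alpha$. Let $x_1,\dots,x_n\in\mathcal{X}$, $y_1,\dots,y_n\in\mathbb{R}$, $\tau>0$, $\lambda_0>0$, and set $\lambda=\tau^4/(4\lambda_0)$. Consider the two problems: (A) minimize over $f\in\mathcal{F}$ $$\frac1n\sum_{i=1}^n\{y_i-f(x_i)\}^2+\tau^2\sum_{\alpha=1}^p\|P^\alpha f\|;$$ (B) minimize over $f\in\mathcal{F}$ and $\theta=(\theta_1,\dots,\theta_p)^{\mathrm T}$ with $\theta_\alpha\ge0$, $\alpha=1,\dots,p$, $$\frac1n\sum_{i=1}^n\{y_i-f(x_i)\}^2+\lambda_0\sum_{\alpha=1}^p\theta_\alpha^{-1}\|P^\alpha f\|^2+\lambda\sum_{\alpha=1}^p\theta_\alpha .$$ Then: (i) if $\hat f$ minimizes (A) and $\hat\theta_\alpha=\lambda_0^{1/2}\lambda^{-1/2}\|P^\alpha\hat f\|$ for $\alpha=1,\dots,p$, then the pair $(\hat\theta,\hat f)$ minimizes (B). (ii) Conversely, if a pair $(\hat\theta,\hat f)$ minimizes (B), then $\hat f$ minimizes (A).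
   Context: Convention: $0/0=0$, and if $\theta_\alpha=0$ then the minimizer is required to satisfy $\|P^\alpha f\|=0$ (equivalently, $\theta_\alpha^{-1}\|P^\alpha f\|^2$ is $0$ if $\theta_\alpha=0$ and $P^\alpha f=0$, and $+\infty$ if $\theta_\alpha=0$ and $P^\alpha f\neq0$). *)

(* Defs.v *)
From HB Require Import structures.
From mathcomp Require Import all_boot all_order all_algebra.
From mathcomp Require Import all_classical all_reals all_analysis.
Set Implicit Arguments.
Unset Strict Implicit.
Unset Printing Implicit Defensive.
Import Order.TTheory GRing.Theory Num.Theory.
Import numFieldNormedType.Exports.
Local Open Scope classical_set_scope.
Local Open Scope ring_scope.

(* A Hilbert space (a complete normed module whose norm comes from an inner
   product) whose elements are functions X -> R: the function underlying f is
   [rkhs_fun f], and the injectivity and linearity of [rkhs_fun] say that the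
   carrier is a linear subspace of X -> R.  Point evaluations are continuous,
   which is the defining property of a reproducing kernel Hilbert space. *)
Record rkhs (R : realType) (X : Type) := Rkhs {
  rkhs_sort :> completeNormedModType R;
  rkhs_dot : {dot rkhs_sort for idfun};
  rkhs_normE : forall f : rkhs_sort, `|f| ^+ 2 = rkhs_dot f f;
  rkhs_fun : {linear rkhs_sort -> (X -> R^o)};
  rkhs_fun_inj : injective rkhs_fun;
  rkhs_eval_continuous : forall x : X,
    continuous (fun f : rkhs_sort => (rkhs_fun f x : R)) }.

Section Decomposition.
Variables (R : realType) (X : Type) (F : rkhs R X).

Definition orthogonal_sets (M N : set F) : Prop :=
  forall f g : F, M f -> N g -> rkhs_dot F f g = 0.

Definition constants : set F :=
  [set f | exists c : R, forall x, rkhs_fun F f x = c].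

(* F = {1} (+) (+)_a Fa a.  Uniqueness of the decomposition and closedness of
   the summands are consequences of orthogonality. *)
Record orthogonal_decomposition (p : nat) (Fa : 'I_p -> set F) : Prop := {
  decomp_one : exists f : F, forall x, rkhs_fun F f x = 1;
  decomp_subspace : forall a, submod_closed (fun f : F => f \in Fa a);
  decomp_orth_constants : forall a, orthogonal_sets constants (Fa a);
  decomp_orth : forall a b, a != b -> orthogonal_sets (Fa a) (Fa b);
  decomp_sum : forall f : F, exists (c : F) (g : 'I_p -> F),
    [/\ constants c, forall a, Fa a (g a) & f = c + \sum_(a < p) g a] }.

Definition orthogonal_projection (M : set F) (P : F -> F) : Prop :=
  forall f : F, M (P f) /\ forall g : F, M g -> rkhs_dot F (f - P f) g = 0.

End Decomposition.

Definition minimizes (d : Order.disp_t) (V : porderType d) (T : Type)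
    (D : set T) (J : T -> V) (t : T) : Prop :=
  D t /\ forall s : T, D s -> (J t <= J s)%O.

Section Objectives.
Variables (R : realType) (X : Type) (F : rkhs R X) (n p : nat).
Variables (P : 'I_p -> F -> F) (x : 'I_n -> X) (y : 'I_n -> R).

Definition loss (f : F) : R :=
  n%:R^-1 * \sum_(i < n) (y i - rkhs_fun F f (x i)) ^+ 2.

Definition objA (tau : R) (f : F) : R :=
  loss f + tau ^+ 2 * \sum_(a < p) `|P a f|.

(* t^-1 * r^2, with the conventions 0/0 = 0 and r^2/0 = +oo for r <> 0. *)
Definition weighted_sq (t r : R) : \bar R :=
  if t == 0 then (if r == 0 then 0%E else +oo%E) else (t^-1 * r ^+ 2)%:E.

Definition objB (lam0 lam : R) (u : ('I_p -> R) * F) : \bar R :=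
  ((loss u.2)%:E + lam0%:E * \sum_(a < p) weighted_sq (u.1 a) `|P a u.2|
   + (lam * \sum_(a < p) u.1 a)%:E)%E.

Definition feasibleB : set (('I_p -> R) * F) :=
  [set u | forall a, 0 <= u.1 a].

End Objectives.

(* Main.v *)
Require Import Defs.
From HB Require Import structures.
From mathcomp Require Import all_boot all_order all_algebra.
From mathcomp Require Import all_classical all_reals all_analysis.
From mathcomp Require Import ring.
Set Implicit Arguments.
Unset Strict Implicit.
Unset Printing Implicit Defensive.
Import Order.TTheory GRing.Theory Num.Theory.
Import numFieldNormedType.Exports.
Local Open Scope classical_set_scope.
Local Open Scope ring_scope.

(** The objective of (A) is what remains of the objective of (B) once the
    weights [theta] have been minimized out, and minimizing a function of two
    variables jointly is the same as first minimizing out one of them.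

    For fixed [f] the [theta]-dependent part of (B) separates into one-variable
    problems: for [r = |P^a f|], minimize [lam0 r^2 / t + lam t] over [t >= 0].
    By the inequality between arithmetic and geometric means the minimum is
    [2 sqrt (lam0 lam) r], attained at [t = sqrt (lam0 / lam) r].  The choice
    [lam = tau^4 / (4 lam0)] makes this minimum equal to [tau^2 r], the penalty
    of (A); under the conventions at [t = 0] the bound persists on the
    boundary, where it is attained exactly when [r = 0].  The bound is
    [weighted_sq_penalty_ge], its attainment [weighted_sq_penalty_eq], and the
    passage between joint and partial minimization [minimizes_profile] and
    [profile_minimizes]. *)

Section Profile.
(** The embedding [e] is there because the profile [A] may take its values in
    a smaller order than [J], as when [J] can be infinite and [A] cannot. *)
Variables (d d' : Order.disp_t) (V : porderType d) (W : porderType d').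
Variables (S T : Type) (D : set S).
Variables (J : S * T -> W) (A : T -> V) (e : V -> W).
Hypothesis e_mono : {mono e : v w / (v <= w)%O}.
Hypothesis A_le : forall s t, D s -> (e (A t) <= J (s, t))%O.

(** As [A] bounds [J] from below, a minimizer of [A] gives a joint minimizer as
    soon as it is paired with one [s] attaining the bound at that point. *)
Lemma minimizes_profile s t : D s -> J (s, t) = e (A t) ->
  minimizes setT A t -> minimizes [set u | D u.1] J (s, t).
Proof.
move=> Ds Jst [_ At]; split=> // -[s' t'] /= Ds'.
by rewrite Jst (le_trans _ (A_le t' Ds'))// e_mono At.
Qed.

(** The converse compares with the best partner of every other [t'], so it
    needs the bound to be attained everywhere, not just at [t]. *)
Lemma profile_minimizes s t :
  (forall t', exists2 s', D s' & J (s', t') = e (A t')) ->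
  minimizes [set u | D u.1] J (s, t) -> minimizes setT A t.
Proof.
move=> attained [/= Ds Jst]; split=> // t' _.
have [s' Ds' Jst'] := attained t'.
by rewrite -e_mono -Jst' (le_trans (A_le t Ds))// Jst.
Qed.

End Profile.

Section Penalty.
Variable R : realType.
Implicit Types tau t r : R.

Lemma weighted_sq_ge0 t r : 0 <= t -> (0 <= weighted_sq t r)%E.
Proof.
move=> t0; rewrite /weighted_sq; case: ifP => _; first by case: ifP.
by rewrite lee_fin mulr_ge0 ?invr_ge0 ?sqr_ge0.
Qed.

Lemma sqrt_ratio tau (lam0 : R) : 0 < tau -> 0 < lam0 ->
  Num.sqrt lam0 * (Num.sqrt (tau ^+ 4 / (4 * lam0)))^-1 = 2 * lam0 / tau ^+ 2.
Proof.
move=> tau0 lam00; have s0 : 0 < Num.sqrt lam0 by rewrite sqrtr_gt0.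
(* [lam0] is written as a square to exhibit [tau^4 / (4 lam0)] as one. *)
have -> : tau ^+ 4 / (4 * lam0) = (tau ^+ 2 / (2 * Num.sqrt lam0)) ^+ 2.
  by rewrite -[in LHS](sqr_sqrtr (ltW lam00)); field; rewrite gt_eqF.
rewrite sqrtr_sqr ger0_norm; last by rewrite divr_ge0 ?sqr_ge0 ?mulr_ge0 ?ltW.
by rewrite -[in RHS](sqr_sqrtr (ltW lam00)); field; rewrite !gt_eqF.
Qed.

(** For [t > 0] the two sides differ by the square
    [(2 lam0 r - tau^2 t)^2 / (4 lam0 t)]. *)
Lemma weighted_sq_penalty_ge tau (lam0 : R) t r : 0 < lam0 -> 0 <= t ->
  ((tau ^+ 2 * r)%:E <=
   lam0%:E * weighted_sq t r + (tau ^+ 4 / (4 * lam0) * t)%:E)%E.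
Proof.
move=> lam00; rewrite le_eqVlt => /orP[/eqP <-|t0].
  rewrite /weighted_sq eqxx mulr0 adde0; case: eqVneq => [->|_].
    by rewrite mulr0 mule0.
  by rewrite gt0_muley ?lte_fin// leey.
rewrite /weighted_sq gt_eqF// -EFinM -EFinD lee_fin -subr_ge0.
have -> : lam0 * (t^-1 * r ^+ 2) + tau ^+ 4 / (4 * lam0) * t - tau ^+ 2 * r
    = (2 * lam0 * r - tau ^+ 2 * t) ^+ 2 / (4 * lam0 * t).
  by field; rewrite !gt_eqF.
by rewrite divr_ge0 ?sqr_ge0 ?mulr_ge0 ?ltW.
Qed.

Lemma weighted_sq_penalty_eq tau (lam0 : R) r : 0 < tau -> 0 < lam0 ->
  (lam0%:E * weighted_sq (2 * lam0 / tau ^+ 2 * r) r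
   + (tau ^+ 4 / (4 * lam0) * (2 * lam0 / tau ^+ 2 * r))%:E
   = (tau ^+ 2 * r)%:E)%E.
Proof.
move=> tau0 lam00; have [->|r0] := eqVneq r 0.
  by rewrite !mulr0 /weighted_sq eqxx mule0 adde0.
have c0 : 2 * lam0 / tau ^+ 2 != 0 by rewrite gt_eqF ?divr_gt0 ?exprn_gt0 ?mulr_gt0.
rewrite /weighted_sq (negbTE (mulf_neq0 c0 r0)) -EFinM -EFinD.
by congr EFin; field; rewrite r0 !gt_eqF.
Qed.

End Penalty.

Section Objectives.
Variables (R : realType) (X : Type) (F : rkhs R X) (n p : nat).
Variables (P : 'I_p -> F -> F) (x : 'I_n -> X) (y : 'I_n -> R).
Variables (tau lam0 : R).

Lemma objA_sum f : (objA P x y tau f)%:E =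
  ((loss x y f)%:E + \sum_(a < p) (tau ^+ 2 * `|P a f|)%:E)%E.
Proof. by rewrite /objA mulr_sumr sumEFin. Qed.

(** Distributing [lam0] over a sum of possibly infinite terms is legitimate
    because these terms are nonnegative. *)
Lemma objB_sum lam (theta : 'I_p -> R) f : (forall a, 0 <= theta a) ->
  objB P x y lam0 lam (theta, f) =
  ((loss x y f)%:E + \sum_(a < p) (lam0%:E * weighted_sq (theta a) `|P a f|
                                   + (lam * theta a)%:E))%E.
Proof.
move=> theta0; rewrite /objB/= big_split/= ge0_sume_distrr; last first.
  by move=> a _; exact: weighted_sq_ge0.
by rewrite mulr_sumr sumEFin addeA.
Qed.

Hypotheses (tau0 : 0 < tau) (lam00 : 0 < lam0).
Let lam := tau ^+ 4 / (4 * lam0).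

Lemma objA_le_objB (theta : 'I_p -> R) f : (forall a, 0 <= theta a) ->
  ((objA P x y tau f)%:E <= objB P x y lam0 lam (theta, f))%E.
Proof.
move=> theta0; rewrite objA_sum objB_sum// leeD2l//.
by apply: lee_sum => a _; exact: weighted_sq_penalty_ge.
Qed.

Definition best_weights (f : F) (a : 'I_p) : R :=
  Num.sqrt lam0 * (Num.sqrt lam)^-1 * `|P a f|.

Lemma best_weights_ge0 f a : 0 <= best_weights f a.
Proof. by rewrite !mulr_ge0 ?invr_ge0 ?sqrtr_ge0. Qed.

Lemma objB_best_weights f :
  objB P x y lam0 lam (best_weights f, f) = (objA P x y tau f)%:E.
Proof.
rewrite objA_sum objB_sum; last exact: best_weights_ge0.
congr (_ + _)%E; apply: eq_bigr => a _.
by rewrite /best_weights /lam sqrt_ratio// weighted_sq_penalty_eq.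
Qed.

End Objectives.

Theorem lemma2 (R : realType) (X : Type) (F : rkhs R X) (n p : nat)
    (Fa : 'I_p -> set F) (P : 'I_p -> F -> F)
    (x : 'I_n -> X) (y : 'I_n -> R) (tau lam0 lam : R)
    (hn : (0 < n)%N)
    (hF : orthogonal_decomposition Fa)
    (hP : forall a, orthogonal_projection (Fa a) (P a))
    (htau : 0 < tau) (hlam0 : 0 < lam0)
    (hlam : lam = tau ^+ 4 / (4 * lam0)) :
  (forall (fhat : F) (thetahat : 'I_p -> R),
     minimizes setT (objA P x y tau) fhat ->
     (forall a, thetahat a = Num.sqrt lam0 * (Num.sqrt lam)^-1 * `|P a fhat|) ->
     minimizes (@feasibleB R X F p) (objB P x y lam0 lam) (thetahat, fhat)) /\
  (forall (fhat : F) (thetahat : 'I_p -> R),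
     minimizes (@feasibleB R X F p) (objB P x y lam0 lam) (thetahat, fhat) ->
     minimizes setT (objA P x y tau) fhat).
Proof.
have le_AB := objA_le_objB P x y tau hlam0.
split=> fhat thetahat; rewrite hlam.
  move=> minA thetaE.
  have -> : thetahat = best_weights P tau lam0 fhat by exact/funext.
  apply: (minimizes_profile (@lee_fin R) le_AB) minA.
    exact: best_weights_ge0.
  exact: objB_best_weights.
apply: (profile_minimizes (@lee_fin R) le_AB) => f.
exists (best_weights P tau lam0 f); first exact: best_weights_ge0.
exact: objB_best_weights.
Qed.
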